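(* Let $A \in \mathbb{C}^{n\times n}$ be a complex matrix with eigenvalues $\lambda_1,\dots,\lambda_n$ (counted with multiplicities), ordered so that $|\lambda_1|\geq\dots\geq|\lambda_n|$, and let $\gamma_1\geq\dots\geq\gamma_n$ be the tropical eigenvalues of $A$ (counted with multiplicities). Then for all $k\in[n]$, $$|\lambda_1\cdots\lambda_k| \leq U_k\,\gamma_1\cdots\gamma_k, \qquad\text{where } U_k=\rho\Bigl(\bigwedge\nolimits^k_{\mathrm{per}}(\mathrm{pat}\,A)\Bigr).$$
   Context: Notation: $[n]=\{1,\dots,n\}$; $\rho$ denotes the spectral radius; $A[I,J]$ is the submatrix of $A$ with rows in $I$ and columns in $J$; $|A|=(|a_{i,j}|)$ is the entrywise absolute value. Pattern: $\mathrm{pat}\,A$ is the $n\times n$ matrix whose $(i,j)$ entry is $0$ if $a_{i,j}=0$ and $1$ otherwise. Permanental compound: $\bigwedge^k_{\mathrm{per}}M$ is the $\binom nk\times\binom nk$ matrix indexed by the $k$-element subsets of $[n]$ with $(I,J)$ entry $\mathrm{per}\,M[I,J]$ (the usual permanent, i.e. the sum over all bijections $\sigma:I\to J$ of $\prod_{i\in I}m_{i,\sigma(i)}$). Tropical eigenvalues: for an $n\times n$ nonnegative matrix $M=(m_{i,j})$, put $\mathrm{tr}^0_{\mathbb{T}}M=1$ and, for $k\in[n]$, $\mathrm{tr}^k_{\mathbb{T}}M=\max_{I\subset[n],\,\#I=k}\ \max_{\sigma\in S_I}\prod_{i\in I}m_{i,\sigma(i)}$, where $S_I$ is the set of permutations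 of $I$. The tropical characteristic polynomial function of $M$ is $q_M(x)=\max_{0\leq k\leq n}(\mathrm{tr}^k_{\mathbb{T}}M)\,x^{n-k}$, $x\geq 0$. It factors uniquely as $q_M(x)=\prod_{i=1}^n\max(x,\gamma_i)$ with $\gamma_1\geq\dots\geq\gamma_n\geq0$ (the positive $\gamma_i$ are the nondifferentiability points of $q_M$). The $\gamma_i$ are the tropical roots of $q_M$, counted with multiplicities, and are called the tropical eigenvalues of $M$. The tropical eigenvalues of a complex matrix $A$ are those of $|A|$. *)

(* Defs.v *)
(* The real numbers are an arbitrary [R : realType], the complex numbers
   are [R[i]]. *)
From HB Require Import structures.
From mathcomp Require Import all_boot all_order all_algebra all_fingroup.
From mathcomp Require Import complex.
From mathcomp Require Import classical_sets reals.

Set Implicit Arguments.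
Unset Strict Implicit.
Unset Printing Implicit Defensive.

Import Order.TTheory GRing.Theory Num.Theory.

Local Open Scope ring_scope.
Local Open Scope complex_scope.

(* The modulus as an element of [R]; the library norm [`|z|] lives in [R[i]]. *)
Definition cabs (R : rcfType) (z : R[i]) : R := ComplexField.Normc.normc z.

Lemma cabsE (R : rcfType) (z : R[i]) : (cabs z)%:C = `|z|.
Proof. by []. Qed.

Definition abs_mx (R : rcfType) (n : nat) (A : 'M[R[i]]_n) : 'M[R]_n :=
  map_mx (@cabs R) A.

Definition pat (F : fieldType) (n : nat) (A : 'M[F]_n) : 'M[F]_n :=
  \matrix_(i, j) (A i j != 0)%:R.

(* [lam] lists the eigenvalues of [A] with algebraic multiplicities. *)
Definition eigenvalues_of (F : fieldType) (n : nat) (A : 'M[F]_n)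
    (lam : 'I_n -> F) : Prop :=
  char_poly A = \prod_(i < n) ('X - (lam i)%:P).

(* The set of moduli is finite, and nonempty when [n > 0], so that the
   supremum is then a maximum. *)
Definition spectral_radius (R : realType) (n : nat) (M : 'M[R[i]]_n) : R :=
  sup [set cabs z | z in [set z : R[i] | eigenvalue M z]]%classic.

Definition permanent (F : comNzRingType) (k : nat) (M : 'M[F]_k) : F :=
  \sum_(s : 'S_k) \prod_(i < k) M i (s i).

Definition ksub (n k : nat) : finType := {I : {set 'I_n} | #|I| == k}.

Lemma card_ksub (n k : nat) : #|ksub n k| = 'C(n, k).
Proof.
rewrite card_sig -[n in RHS]card_ord -card_draws -cardsE.
by apply: eq_card => I; rewrite !inE.
Qed.

(* The elements of a [k]-subset, in increasing order. *)
Definition ksub_nth (n k : nat) (I : ksub n k) (r : 'I_k) : 'I_n :=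
  enum_val (cast_ord (esym (eqP (valP I))) r).

Definition ksubmx (F : Type) (n k : nat) (M : 'M[F]_n) (I J : ksub n k) :
    'M[F]_k :=
  mxsub (ksub_nth I) (ksub_nth J) M.

Definition per_compound (F : comNzRingType) (n k : nat) (M : 'M[F]_n) :
    'M[F]_#|ksub n k| :=
  \matrix_(a, b) permanent (ksubmx M (enum_val a) (enum_val b)).

(* Permutations of [I] are the permutations of ['I_n] with support in [I].
   [M] is meant to be nonnegative, so that the default value 0 of the maxima
   is harmless; for [k = 0] the value is the empty product 1. *)
Definition trop_tr (R : realType) (n : nat) (M : 'M[R]_n) (k : nat) : R :=
  \big[Num.max/0]_(I : {set 'I_n} | #|I| == k)
    \big[Num.max/0]_(s : {perm 'I_n} | perm_on I s) \prod_(i in I) M i (s i).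

Definition trop_char_poly (R : realType) (n : nat) (M : 'M[R]_n) (x : R) : R :=
  \big[Num.max/0]_(k < n.+1) (trop_tr M k * x ^+ (n - k)).

(* [gam] lists the tropical roots of the tropical characteristic polynomial
   function, with multiplicities and in nonincreasing order. *)
Definition trop_eigenvalues_of (R : realType) (n : nat) (M : 'M[R]_n)
    (gam : 'I_n -> R) : Prop :=
  [/\ forall i, 0 <= gam i,
      forall i j : 'I_n, (i <= j)%N -> gam j <= gam i
    & forall x : R, 0 <= x ->
        trop_char_poly M x = \prod_(i < n) Num.max x (gam i)].

Definition ctrop_eigenvalues_of (R : realType) (n : nat) (A : 'M[R[i]]_n)
    (gam : 'I_n -> R) : Prop :=
  trop_eigenvalues_of (abs_mx A) gam.

Lemma trop_tr0 (R : realType) (n : nat) (M : 'M[R]_n) : trop_tr M 0 = 1.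
Proof.
rewrite /trop_tr (big_pred1_id _ _ (i := finset.set0)) => [|I].
  2: by rewrite cards_eq0.
rewrite (big_pred1_id _ _ (i := 1%g)) => [|s].
  by rewrite big_set0 !(max_l ler01).
apply/idP/eqP => [sI|->]; last exact: perm_on1.
by apply/permP => i; rewrite perm1 (out_perm sI) // inE.
Qed.

(* Main.v *)
(* For x > 0, let B be the entrywise maximum of |A| and xI. The optimal
   assignment problem for B has value q(x), the tropical characteristic
   polynomial of |A| at x, and its dual provides u, v > 0 with
   |a_ij| <= u_i v_j, x <= u_i v_i and prod_i u_i v_i = q(x). Hence
   |det A[I,J]| <= u_I v_J per (pat A)[I,J], where u_I v_I <= q(x) / x^(n-k) = c
   for every k-subset I. Along a closed walk I_1, ..., I_m, I_1 these factors
   multiply to at most c^m, so the trace of the m-th power of the k-th compound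
   of A is at most c^m times that of the permanental compound P of pat A, hence
   O((c rho(P))^m). By Cauchy-Binet that trace is the power sum
   sum_I lam_I^m, where lam_I is the product of the lam_i with i in I; an
   interpolation argument bounds each |lam_I| by c rho(P). Finally, if
   gamma_k > 0, then c = gamma_1 ... gamma_k for x = gamma_k, and otherwise c
   tends to 0 with x. *)
Require Import Defs.
From HB Require Import structures.
From mathcomp Require Import all_boot all_order all_algebra all_fingroup.
From mathcomp Require Import complex ring.
From mathcomp Require Import classical_sets reals.

Set Implicit Arguments.
Unset Strict Implicit.
Unset Printing Implicit Defensive.

Import Order.TTheory GRing.Theory Num.Theory.

Local Open Scope ring_scope.
Local Open Scope complex_scope.

(** * Enumeration of [k]-subsets and the Cauchy-Binet formula *)

Lemma ksub_nth_inj (n k : nat) (I : ksub n k) : injective (ksub_nth I).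
Proof. by move=> r s /enum_val_inj /cast_ord_inj. Qed.

Lemma ksub_nthP (n k : nat) (I : ksub n k) (i : 'I_n) :
  reflect (exists r, ksub_nth I r = i) (i \in val I).
Proof.
apply: (iffP idP) => [iI | [r <-]]; last exact: enum_valP.
exists (cast_ord (eqP (valP I)) (enum_rank_in iI i)).
by rewrite /ksub_nth cast_ordK enum_rankK_in.
Qed.

(** Monotonicity makes principal submatrices of triangular matrices triangular. *)
Lemma ksub_nth_mono (n k : nat) (I : ksub n k) (r s : 'I_k) :
  (r < s)%N -> (ksub_nth I r < ksub_nth I s)%N.
Proof.
move=> lt_rs; have i0 := ksub_nth I r.
rewrite /ksub_nth !(enum_val_nth i0) /=.
have sort_I : sorted ltn (map val (enum (val I))).
  apply: (subseq_sorted ltn_trans _ (iota_ltn_sorted 0 n)).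
  by rewrite -val_enum_ord map_subseq // {1}/enum_mem enumT filter_subseq.
have sz : size (enum (val I)) = k by rewrite -cardE (eqP (valP I)).
have nthE t : (t < k)%N ->
    nat_of_ord (nth i0 (enum (val I)) t) = nth 0%N (map val (enum (val I))) t.
  by move=> lt_tk; rewrite (nth_map i0) ?sz.
rewrite !nthE //; apply: (sorted_ltn_nth ltn_trans 0%N sort_I) => //;
  by rewrite inE size_map sz.
Qed.

Lemma prod_ksub_nth (R : comNzRingType) (n k : nat) (I : ksub n k)
    (F : 'I_n -> R) :
  \prod_(r < k) F (ksub_nth I r) = \prod_(i in val I) F i.
Proof.
transitivity (\prod_(i in ksub_nth I @: 'I_k) F i).
  by rewrite big_imset //= => r s _ _; exact: ksub_nth_inj.
apply: eq_bigl => i; apply/imsetP/ksub_nthP => [[r _ ->]|[r <-]]; by exists r.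
Qed.

(** A [k]-subset and a permutation encode an injection of ['I_k] into ['I_n] by its image and its
    arrangement; every injection arises exactly once. *)
Definition ksub_ffun (n k : nat) (Js : ksub n k * 'S_k) : {ffun 'I_k -> 'I_n} :=
  [ffun r => ksub_nth Js.1 (Js.2 r)].

Lemma ksub_ffun_inj (n k : nat) : injective (@ksub_ffun n k).
Proof.
move=> [I s] [J t] /ffunP eq_IJ.
have {}eq_IJ r : ksub_nth I (s r) = ksub_nth J (t r).
  by have := eq_IJ r; rewrite !ffunE.
have eqI : I = J.
  apply/val_inj/setP => i; apply/ksub_nthP/ksub_nthP => -[r <-].
    by exists (t (s^-1 r)%g); rewrite -eq_IJ permKV.
  by exists (s (t^-1 r)%g); rewrite eq_IJ permKV.
subst J; congr (_, _); apply/permP => r.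
exact: ksub_nth_inj (eq_IJ r).
Qed.

Lemma ksub_ffun_surj (n k : nat) (f : {ffun 'I_k -> 'I_n}) :
  injectiveb f -> exists Js, f = ksub_ffun Js.
Proof.
move=> /injectiveP f_inj.
have cardI : #|f @: 'I_k| == k by rewrite card_imset ?card_ord.
pose I : ksub n k := exist _ (f @: 'I_k) cardI.
have fI r : exists s, ksub_nth I s == f r.
  have /ksub_nthP[s Es] : f r \in val I by rewrite imset_f.
  by exists s; apply/eqP.
pose g r := xchoose (fI r).
have gE r : ksub_nth I (g r) = f r by apply/eqP/(xchooseP (fI r)).
have g_inj : injective g by move=> r s eq_g; apply: f_inj; rewrite -!gE eq_g.
by exists (I, perm g_inj); apply/ffunP => r; rewrite ffunE /= permE gE.
Qed.

(** Multilinearity in the rows of [X *m Y] gives a sum over all maps [f]. A non-injective [f]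
    repeats a row of [Y] and contributes 0; the injective ones are grouped by their image [J]. *)
Lemma Cauchy_Binet (R : comNzRingType) (n k : nat) (X : 'M[R]_(k, n))
    (Y : 'M[R]_(n, k)) :
  \det (X *m Y) =
    \sum_(J : ksub n k) \det (colsub (ksub_nth J) X) * \det (rowsub (ksub_nth J) Y).
Proof.
transitivity (\sum_(f : {ffun 'I_k -> 'I_n})
                 (\prod_i X i (f i)) * \det (rowsub f Y)).
  rewrite /determinant.
  under [RHS]eq_bigr do rewrite big_distrr /=.
  rewrite exchange_big; apply: eq_bigr => s _ /=.
  under eq_bigr do rewrite mxE.
  rewrite bigA_distr_bigA big_distrr; apply: eq_bigr => f _ /=.
  rewrite mulrCA -big_split; congr (_ * _).
  by apply: eq_bigr => i _; rewrite !mxE.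
rewrite (bigID (fun f : {ffun 'I_k -> 'I_n} => injectiveb f)) /= addrC big1 => [|f]; last first.
  move=> /injectivePn[r [s neq_rs eq_f]].
  rewrite (determinant_alternate neq_rs) ?mulr0 // => j.
  by rewrite !mxE eq_f.
rewrite add0r.
rewrite (eq_bigl [in @ksub_ffun n k @: {: ksub n k * 'S_k}]) => [|f]; last first.
  apply/idP/imsetP => [/ksub_ffun_surj[Js ->]|[[J s] _ ->]]; first by exists Js.
  by apply/injectiveP => r t; rewrite !ffunE => /ksub_nth_inj/perm_inj.
rewrite big_imset /=; last by move=> ? ? _ _; exact: ksub_ffun_inj.
rewrite -(pair_bigA _ (fun J s => (\prod_i X i (ksub_ffun (J, s) i)) *
   \det (rowsub (ksub_ffun (J, s)) Y))) /=.
apply: eq_bigr => J _; rewrite [in RHS]/determinant big_distrl /=.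
apply: eq_bigr => s _.
have -> : rowsub (ksub_ffun (J, s)) Y = perm_mx s *m rowsub (ksub_nth J) Y.
  by rewrite -row_permE; apply/matrixP => i j; rewrite !mxE ffunE.
rewrite det_mulmx det_perm mulrA; congr (_ * _); rewrite mulrC; congr (_ * _).
by apply: eq_bigr => i _; rewrite !mxE ffunE.
Qed.

(** * The determinantal compound *)

(** The matrix of the [k]-th exterior power, on the index type of [per_compound] so that the two
    compare entrywise. *)
Definition det_compound (R : comNzRingType) (n k : nat) (M : 'M[R]_n) :
    'M[R]_#|ksub n k| :=
  \matrix_(a, b) \det (ksubmx M (enum_val a) (enum_val b)).

Lemma det_compoundM (R : comNzRingType) (n k : nat) (A B : 'M[R]_n) :
  det_compound k (A *m B) = det_compound k A *m det_compound k B.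
Proof.
apply/matrixP => a b; rewrite !mxE.
have -> : ksubmx (A *m B) (enum_val a) (enum_val b) =
    rowsub (ksub_nth (enum_val a)) A *m colsub (ksub_nth (enum_val b)) B.
  by apply/matrixP => i j; rewrite !mxE; apply: eq_bigr => l _; rewrite !mxE.
rewrite Cauchy_Binet (reindex_onto enum_val enum_rank) => [|J _]; last exact: enum_rankK.
under eq_bigl do rewrite enum_valK eqxx.
apply: eq_bigr => c _; rewrite !mxE.
by congr (_ * _); congr (\det _); apply/matrixP => i j; rewrite !mxE.
Qed.

Lemma det_compound1 (R : comNzRingType) (n k : nat) :
  det_compound k (1%:M : 'M[R]_n) = 1%:M.
Proof.
apply/matrixP => a b; rewrite !mxE.
have [<-|neq_ab] := eqVneq a b.
  rewrite -[RHS](det1 R k); congr (\det _); apply/matrixP => i j; rewrite !mxE.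
  by rewrite (inj_eq (@ksub_nth_inj _ _ _)).
(* An element of the first set outside the second gives a zero row; if there is none, inclusion and
   equal cardinality force equality. *)
have [r rP|no_r] := pickP (fun r => ksub_nth (enum_val a) r \notin val (enum_val b)).
  rewrite (expand_det_row _ r) big1 // => j _; rewrite !mxE.
  case: eqP => [eq_rj|_]; last by rewrite mul0r.
  by case/negP: rP; apply/ksub_nthP; exists j.
case/negP: neq_ab; apply/eqP/enum_val_inj/val_inj/eqP.
rewrite eqEcard (eqP (valP (enum_val a))) (eqP (valP (enum_val b))) leqnn andbT.
by apply/fintype.subsetP => i /ksub_nthP[r <-]; have /negbFE := no_r r.
Qed.

Lemma det_compoundX (R : comNzRingType) (n k : nat) (A : 'M[R]_n) (m : nat) :
  det_compound k (A ^+ m) = det_compound k A ^+ m.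
Proof.
elim: m => [|m IHm]; first by rewrite !expr0 det_compound1.
by rewrite !exprS det_compoundM IHm.
Qed.

(** * Triangularization and traces of powers as power sums *)

Lemma char_poly_similar (F : fieldType) (n : nat) (P A T : 'M[F]_n) :
  P \in unitmx -> P *m A = T *m P -> char_poly A = char_poly T.
Proof.
move=> Pu PA; pose Q := map_mx polyC P.
have Q0 : \det Q != 0 by rewrite det_map_mx polyC_eq0 -unitfE -unitmxE.
apply: (mulfI Q0); rewrite /char_poly [RHS]mulrC -!det_mulmx; congr (\det _).
by rewrite mulmxBr mulmxBl -!map_mxM PA mul_mx_scalar mul_scalar_mx.
Qed.

Lemma trigonalization (C : numClosedFieldType) (n : nat) (A : 'M[C]_n) :
  exists P T : 'M[C]_n, [/\ P \in unitmx, P *m A = T *m P & is_trig_mx T].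
Proof.
case: n => [|n] in A *.
  exists 1%:M, 0; split; rewrite ?unitmx1 //; last exact: mx0_is_trig.
  by apply/matrixP => -[].
have [P /unitarymx_unit Pu T_trig] := Schur A (ltn0Sn n).
exists P, (conjmx P A); split=> //.
by rewrite conjumx // mulmxKV.
Qed.

(** Unique factorization of the characteristic polynomial makes the diagonal of a triangular form a
    rearrangement of [lam]. *)
Lemma eigenvalues_trig (C : numClosedFieldType) (n : nat) (A : 'M[C]_n)
    (lam : 'I_n -> C) : eigenvalues_of A lam ->
  exists P T : 'M[C]_n, exists s : 'S_n,
    [/\ P \in unitmx, P *m A = T *m P, is_trig_mx T &
        forall i, T i i = lam (s i)].
Proof.
move=> Alam.
have [P [T [Pu PA T_trig]]] := trigonalization A.
exists P, T.
have /prod_XsubC_eq : \prod_(x <- [tuple T i i | i < n]) ('X - x%:P) =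
    \prod_(x <- [tuple lam i | i < n]) ('X - x%:P).
  rewrite !big_tuple; under eq_bigr do rewrite tnth_mktuple.
  under [RHS]eq_bigr do rewrite tnth_mktuple.
  by rewrite -char_poly_trig // -(char_poly_similar Pu PA).
case/tuple_permP => s /val_inj/(congr1 (fun t => tnth t _)) Ts.
by exists s; split=> // i; have := Ts i; rewrite !tnth_mktuple.
Qed.

Lemma trig_mxX (R : comNzRingType) (n : nat) (T : 'M[R]_n) (m : nat) :
  is_trig_mx T -> is_trig_mx (T ^+ m) /\ forall i, (T ^+ m) i i = T i i ^+ m.
Proof.
move=> /is_trig_mxP T0; elim: m => [|m [/is_trig_mxP Tm0 Tmd]].
  by rewrite expr0; split; [exact: scalar_mx_is_trig | move=> i; rewrite mxE eqxx].
split=> [|i]; last first.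
  rewrite !exprS mxE (bigD1 i) //= Tmd big1 ?addr0 // => j neq_ji.
  case: (ltngtP i j) => [ij|ji|/val_inj eq_ij]; first by rewrite T0 ?mul0r.
    by rewrite Tm0 ?mulr0.
  by rewrite eq_ij eqxx in neq_ji.
apply/is_trig_mxP => i j lt_ij; rewrite exprS mxE big1 // => l _.
case: (ltnP i l) => [il|li]; first by rewrite T0 ?mul0r.
by rewrite Tm0 ?mulr0 // (leq_ltn_trans li).
Qed.

Lemma similarX (F : fieldType) (n : nat) (P A T : 'M[F]_n) (m : nat) :
  P *m A = T *m P -> P *m A ^+ m = T ^+ m *m P.
Proof.
move=> PA; elim: m => [|m IHm]; first by rewrite !expr0 mulmx1 mul1mx.
by rewrite exprSr [in RHS]exprSr -mulmxA -PA !mulmxA -IHm.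
Qed.

Lemma trace_similar (F : fieldType) (n : nat) (P A T : 'M[F]_n) :
  P \in unitmx -> P *m A = T *m P -> \tr A = \tr T.
Proof.
by move=> Pu PA; rewrite -[A](mulKmx Pu) PA mxtrace_mulC mulmxK.
Qed.

Lemma trace_eigenvaluesX (C : numClosedFieldType) (n : nat) (A : 'M[C]_n)
    (lam : 'I_n -> C) (m : nat) :
  eigenvalues_of A lam -> \tr (A ^+ m) = \sum_i lam i ^+ m.
Proof.
move=> /eigenvalues_trig[P [T [s [Pu PA T_trig Td]]]].
rewrite (trace_similar Pu (similarX m PA)) [RHS](reindex_inj (@perm_inj _ s)) /=.
by apply: eq_bigr => i _; rewrite (trig_mxX m T_trig).2 Td.
Qed.

(** By multiplicativity, the compound of [P] conjugates the compound of [A] to that of [T]. The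
    diagonal entries of the compound of [T ^+ m] are principal minors of a triangular matrix, hence
    products of [m]-th powers of eigenvalues. *)
Lemma trace_det_compoundX (C : numClosedFieldType) (n k : nat) (A : 'M[C]_n)
    (lam : 'I_n -> C) (m : nat) :
  eigenvalues_of A lam ->
  \tr (det_compound k A ^+ m) =
    \sum_(I : {set 'I_n} | #|I| == k) (\prod_(i in I) lam i) ^+ m.
Proof.
move=> /eigenvalues_trig[P [T [s [Pu PA T_trig Td]]]].
have CPu : det_compound k P \in unitmx.
  have : det_compound k P *m det_compound k (invmx P) = 1%:M.
    by rewrite -det_compoundM mulmxV // det_compound1.
  by case/mulmx1_unit.
have CPA : det_compound k P *m det_compound k A =
    det_compound k T *m det_compound k P by rewrite -!det_compoundM PA.
rewrite (trace_similar CPu (similarX m CPA)) -det_compoundX.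
have [/is_trig_mxP Tm0 Tmd] := trig_mxX m T_trig.
transitivity (\sum_(a < #|ksub n k|)
    (\prod_(i in val (enum_val a)) lam (s i)) ^+ m).
  apply: eq_bigr => a _; rewrite mxE det_trig; last first.
    by apply/is_trig_mxP => i j lt_ij; rewrite mxE Tm0 ?ksub_nth_mono.
  rewrite -prod_ksub_nth -prodrXl; apply: eq_bigr => i _.
  by rewrite mxE Tmd Td.
rewrite -(big_enum_val (fun I : ksub n k => (\prod_(i in val I) lam (s i)) ^+ m)) /=.
transitivity (\sum_(I : {set 'I_n} | #|I| == k)
    (\prod_(i in I) lam (s i)) ^+ m).
  rewrite [RHS](reindex_omap (val : ksub n k -> _) insub) => [|I Ik]; last first.
    by rewrite insubT.
  by apply: eq_bigl => I; rewrite (eqP (valP I)) eqxx valK eqxx.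
(* Replacing each set by its image under [s] removes the rearrangement. *)
rewrite [RHS](reindex_onto (fun I : {set 'I_n} => s @: I) (fun I => s @^-1: I)) => [|I _]; last first.
  apply/setP => i; apply/imsetP/idP => [[j sj ->]|iI]; first by rewrite inE in sj.
  by exists (s^-1 i)%g; rewrite ?inE permKV.
rewrite [RHS](eq_bigl (fun I : {set 'I_n} => #|I| == k)) => [|I]; last first.
  rewrite card_imset; last exact: perm_inj.
  rewrite andbC; case: eqP => // -[]; apply/setP => i.
  by rewrite inE mem_imset //; exact: perm_inj.
apply: eq_bigr => I _; congr (_ ^+ _).
by rewrite big_imset //= => i j _ _; exact: perm_inj.
Qed.

(** * Growth of power sums *)

Lemma cabs_ge0 (R : rcfType) (z : R[i]) : 0 <= cabs z.
Proof. by rewrite -lecR cabsE; exact: (normr_ge0 z). Qed.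

Lemma bernoulli_ineq (R : numDomainType) (t : R) (m : nat) :
  0 <= t -> 1 + m%:R * t <= (1 + t) ^+ m.
Proof.
move=> t0; elim: m => [|m IHm]; first by rewrite mul0r addr0 expr0.
rewrite exprS; apply: le_trans (ler_wpM2l (addr_ge0 ler01 t0) IHm).
rewrite -subr_ge0; have -> : (1 + t) * (1 + m%:R * t) - (1 + m.+1%:R * t) =
    m%:R * t ^+ 2 by ring.
by rewrite mulr_ge0 ?exprn_ge0.
Qed.

(** If [0 < b < a], the powers of [a / b] are at most [K / d], yet grow at least linearly by
    Bernoulli, against the Archimedean property. For [b = 0] the exponent 1 suffices. *)
Lemma expr_dominated (R : archiRealFieldType) (a b d K : R) :
  0 <= b -> 0 < d -> (forall m, a ^+ m * d <= K * b ^+ m) -> a <= b.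
Proof.
move=> b0 d0 dom; rewrite leNgt; apply/negP => lt_ba.
have [b_eq0|/negP b_neq0] := boolP (b == 0).
  have := dom 1%N; rewrite (eqP b_eq0) !expr1 mulr0 leNgt mulr_gt0 //.
  by rewrite -(eqP b_eq0).
have {b0 b_neq0} b0 : 0 < b by rewrite lt0r b0 andbT; apply/negP.
pose t := a / b - 1.
have t0 : 0 < t by rewrite subr_gt0 ltr_pdivlMr // mul1r.
have bound m : m%:R * t <= K / d.
  have : (1 + t) ^+ m <= K / d.
    rewrite addrC subrK expr_div_n ler_pdivrMr ?exprn_gt0 //.
    by rewrite mulrAC ler_pdivlMr.
  apply: le_trans; apply: le_trans (bernoulli_ineq m (ltW t0)).
  by rewrite lerDr ler01.
have := archi_boundP (normr_ge0 (K / d / t)).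
rewrite ltNge; apply/negP; rewrite negbK.
apply: le_trans (ler_norm _); rewrite ler_pdivlMr //.
Qed.

(** Let [p] vanish at all values of [mu] other than [mu i0]. Combining consecutive power sums with
    the coefficients of [p] leaves a nonzero multiple of [mu i0 ^+ m], and this combination is still
    dominated by [b ^+ m]. *)
Lemma power_sums_dominated (R : realType) (I : finType) (Q : pred I)
    (mu : I -> R[i]) (K b : R) : 0 <= b ->
  (forall m, `|\sum_(i | Q i) mu i ^+ m| <= (K * b ^+ m)%:C) ->
  forall i, Q i -> cabs (mu i) <= b.
Proof.
move=> b0 dom i0 Qi0.
pose s := [seq x <- undup [seq mu i | i : I] | x != mu i0].
pose p := \prod_(x <- s) ('X - x%:P).
have p_i0 : p.[mu i0] != 0.
  apply/negP => /eqP/rootP; rewrite root_prod_XsubC mem_filter.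
  by rewrite eqxx.
have p_i i : mu i != mu i0 -> p.[mu i] = 0.
  move=> neq_i; apply/rootP; rewrite root_prod_XsubC mem_filter neq_i /= mem_undup.
  exact: codom_f.
(* The multiplicity of the value [mu i0]; terms with equal values add up and cannot cancel. *)
pose N := #|[pred i | Q i & mu i == mu i0]|.
have N0 : (0 < N)%N by apply/card_gt0P; exists i0; rewrite inE Qi0 eqxx.
have sumE m : \sum_(j < size p) p`_j * \sum_(i | Q i) mu i ^+ (m + j) =
    mu i0 ^+ m * (p.[mu i0] *+ N).
  under eq_bigr do rewrite big_distrr /=.
  rewrite exchange_big /= mulrnAr -sumr_const.
  rewrite (bigID (fun i => mu i == mu i0)) /= [X in _ + X]big1 => [|i /andP[_ neq_i]].
    rewrite addr0; apply: eq_big => [i|i /andP[_ /eqP->]]; first by rewrite !inE.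
    rewrite horner_coef mulr_sumr; apply: eq_bigr => j _.
    by rewrite exprD mulrCA.
  transitivity (mu i ^+ m * p.[mu i]); last by rewrite p_i ?mulr0.
  rewrite horner_coef mulr_sumr; apply: eq_bigr => j _.
  by rewrite exprD mulrCA.
pose L := \sum_(j < size p) cabs p`_j * (K * b ^+ j).
apply: (@expr_dominated R _ _ (cabs p.[mu i0] *+ N) L) => //.
  rewrite pmulrn_lgt0 // -ltcR cabsE normr_gt0 //.
move=> m; rewrite -lecR !(rmorphM, rmorphXn, rmorphMn) /= !cabsE -normrX -normrMn -normrM.
rewrite -sumE; apply: le_trans (ler_norm_sum _ _ _) _.
rewrite -!(rmorphM, rmorphXn) /= mulr_suml rmorph_sum /=; apply: ler_sum => j _.
rewrite normrM -cabsE -mulrA -mulrA -exprD rmorphM /= addnC; apply: ler_wpM2l => //.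
by rewrite cabsE.
Qed.

(** * Spectral radius and traces *)

Lemma eigenvalues_exist (C : numClosedFieldType) (n : nat) (A : 'M[C]_n) :
  exists lam, eigenvalues_of A lam.
Proof.
have [P [T [Pu PA T_trig]]] := trigonalization A.
exists (fun i => T i i); rewrite /eigenvalues_of.
by rewrite (char_poly_similar Pu PA) char_poly_trig.
Qed.

Lemma eigenvalue_ofP (F : fieldType) (n : nat) (A : 'M[F]_n) (lam : 'I_n -> F)
    (z : F) : eigenvalues_of A lam -> reflect (exists i, z = lam i) (eigenvalue A z).
Proof.
move=> Alam; rewrite eigenvalue_root_char Alam.
rewrite -(big_map lam xpredT (fun x => 'X - x%:P)) root_prod_XsubC.
by apply: (iffP mapP) => [[i _ ->]|[i ->]]; exists i; rewrite ?mem_index_enum.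
Qed.

Lemma le_spectral_radius (R : realType) (n : nat) (M : 'M[R[i]]_n) (z : R[i]) :
  eigenvalue M z -> cabs z <= spectral_radius M.
Proof.
have [lam Mlam] := eigenvalues_exist M => Mz.
apply: ub_le_sup; last by exists z.
(* The sum of all moduli bounds the set from above, as the supremum requires. *)
exists (\sum_i cabs (lam i)) => _ [y /= /(eigenvalue_ofP y Mlam) [i ->] <-].
by rewrite (bigD1 i) //= lerDl sumr_ge0 // => j _; exact: cabs_ge0.
Qed.

Lemma spectral_radius_ge0 (R : realType) (n : nat) (M : 'M[R[i]]_n) :
  0 <= spectral_radius M.
Proof.
have [lam Mlam] := eigenvalues_exist M.
case: n => [|n] in M lam Mlam *.
  (* In dimension 0 the set of moduli is empty and its supremum is the default value 0. *)
  rewrite /spectral_radius (_ : [set _ | _ in _]%classic = classical_sets.set0) ?sup0 //.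
  by rewrite -subset0 => y [z /= /(eigenvalue_ofP z Mlam) [[]]].
apply: le_trans (cabs_ge0 (lam ord0)) (le_spectral_radius _).
by apply/(eigenvalue_ofP _ Mlam); exists ord0.
Qed.

Lemma norm_trace_le (R : realType) (n : nat) (M : 'M[R[i]]_n) (m : nat) :
  `|\tr (M ^+ m)| <= (n%:R * spectral_radius M ^+ m)%:C.
Proof.
have [lam Mlam] := eigenvalues_exist M.
rewrite (trace_eigenvaluesX m Mlam); apply: le_trans (ler_norm_sum _ _ _) _.
rewrite mulr_natl -[n in _ *+ n]card_ord -sumr_const rmorph_sum /=.
apply: ler_sum => i _; rewrite normrX -cabsE -rmorphXn lecR lerXn2r //.
- exact: cabs_ge0.
- rewrite nnegrE; apply: le_trans (le_spectral_radius (z := lam i) _).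
    exact: cabs_ge0.
  by apply/(eigenvalue_ofP _ Mlam); exists i.
- by apply: le_spectral_radius; apply/(eigenvalue_ofP _ Mlam); exists i.
Qed.

(** * Comparison with a nonnegative matrix after diagonal scaling *)

(** The hypothesis, written without division, says that [M] conjugated by the diagonal matrix of [d]
    is dominated entrywise by [c] times [P]. Conjugation commutes with powers, and domination by a
    nonnegative matrix passes to them. *)
Lemma norm_mxX_le (F : numDomainType) (n : nat) (M P : 'M[F]_n) (d : 'I_n -> F)
    (c : F) : (forall i, 0 < d i) -> 0 <= c -> (forall i j, 0 <= P i j) ->
  (forall i j, `|M i j| * d i <= c * P i j * d j) ->
  forall m i j, `|(M ^+ m) i j| * d i <= c ^+ m * (P ^+ m) i j * d j.
Proof.
move=> d0 c0 P0 MP; elim=> [|m IHm] i j.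
  rewrite !expr0 !mxE mul1r; case: eqP => [->|_]; last by rewrite normr0 !mul0r.
  by rewrite normr1.
rewrite !exprS !mxE.
apply: (@le_trans _ _ (\sum_l `|M i l| * `|(M ^+ m) l j| * d i)).
  rewrite -mulr_suml ler_wpM2r ?(ltW (d0 i)) //.
  by apply: le_trans (ler_norm_sum _ _ _) _; apply: ler_sum => l _; rewrite normrM.
rewrite mulr_sumr mulr_suml; apply: ler_sum => l _.
apply: (@le_trans _ _ (c * P i l * d l * `|(M ^+ m) l j|)).
  by rewrite mulrAC ler_wpM2r.
rewrite -mulrA [d l * _]mulrC.
have -> : c * c ^+ m * (P i l * (P ^+ m) l j) * d j =
    c * P i l * (c ^+ m * (P ^+ m) l j * d j).
  by rewrite !mulrA [c * c ^+ m * _]mulrAC.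
by rewrite ler_wpM2l // mulr_ge0.
Qed.

Lemma norm_traceX_le (F : numFieldType) (n : nat) (M P : 'M[F]_n)
    (d : 'I_n -> F) (c : F) :
  (forall i, 0 < d i) -> 0 <= c -> (forall i j, 0 <= P i j) ->
  (forall i j, `|M i j| * d i <= c * P i j * d j) ->
  forall m, `|\tr (M ^+ m)| <= c ^+ m * \tr (P ^+ m).
Proof.
move=> d0 c0 P0 MP m; apply: le_trans (ler_norm_sum _ _ _) _.
rewrite mulr_sumr; apply: ler_sum => i _.
by rewrite -(ler_pM2r (d0 i)); apply: norm_mxX_le.
Qed.

(** The products over [k]-subsets have as power sums the traces of powers of the compound, which are
    at most a constant times [(spectral_radius P * c) ^+ m]. *)
Lemma eigenvalue_products_le (R : realType) (n k : nat) (A : 'M[R[i]]_n)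
    (lam : 'I_n -> R[i]) (P : 'M[R[i]]_#|ksub n k|)
    (d : 'I_#|ksub n k| -> R[i]) (c : R) :
  eigenvalues_of A lam -> (forall a, 0 < d a) -> 0 <= c ->
  (forall a b, 0 <= P a b) ->
  (forall a b, `|det_compound k A a b| * d a <= c%:C * P a b * d b) ->
  forall I : {set 'I_n}, #|I| == k ->
    cabs (\prod_(i in I) lam i) <= spectral_radius P * c.
Proof.
move=> Alam d0 c0 P0 dom.
move=> I Ik.
have rho0 : 0 <= spectral_radius P * c by rewrite mulr_ge0 ?spectral_radius_ge0.
have c0' : 0 <= c%:C by rewrite lecR.
apply: (@power_sums_dominated R _ (fun I : {set 'I_n} => #|I| == k)
  (fun I => \prod_(i in I) lam i) #|ksub n k|%:R _ rho0) => // m.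
rewrite -(trace_det_compoundX k m Alam).
have tr_le := norm_traceX_le d0 c0' P0 dom m.
apply: (le_trans tr_le).
(* The right-hand side dominates a norm, so it equals its own norm and [norm_trace_le] can be
   applied to it. *)
rewrite -(ger0_norm (le_trans (normr_ge0 _) tr_le)) normrM normrX (ger0_norm c0').
rewrite exprMn mulrA [in leRHS]mulrC rmorphM rmorphXn ler_wpM2l ?exprn_ge0 //.
exact: norm_trace_le.
Qed.

(** * Walks, potentials and duality for the assignment problem *)

Fixpoint path_weight (R : pzRingType) (T : Type) (E : T -> T -> R) (i : T)
    (s : seq T) : R :=
  if s is j :: s' then E i j * path_weight E j s' else 1.

Lemma path_weight_cat (R : pzRingType) (T : Type) (E : T -> T -> R) (i : T)
    (s1 s2 : seq T) :
  path_weight E i (s1 ++ s2) = path_weight E i s1 * path_weight E (last i s1) s2.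
Proof.
elim: s1 i => [|j s1 IHs] i /=; first by rewrite mul1r.
by rewrite IHs mulrA.
Qed.

(** The weight of a simple cycle becomes a product over its vertices, so that the cycle can be read
    as the permutation [next]. *)
Lemma path_weight_next_at (R : pzRingType) (T : eqType) (E : T -> T -> R)
    (z y : T) (s : seq T) : uniq (y :: s) ->
  path_weight E y (rcons s z) = \prod_(x <- y :: s) E x (next_at x z y s).
Proof.
elim: s y => [|x s IHs] y; first by rewrite /= big_seq1 /= eqxx mulr1.
move=> uniq_yxs; have /andP[y_xs uniq_xs] := uniq_yxs.
rewrite rcons_cons big_cons /= eqxx; congr (_ * _).
rewrite IHs // big_seq [RHS]big_seq; apply: eq_bigr => w w_xs.
by case: eqP => // eq_wy; rewrite -eq_wy w_xs in y_xs.
Qed.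

Section Potential.

Variables (R : realFieldType) (T : finType) (E : T -> T -> R).
Hypotheses (E_ge0 : forall i j, 0 <= E i j) (E_diag : forall i, E i i = 1).
Hypothesis E_perm : forall s : {perm T}, \prod_i E i (s i) <= 1.

Lemma path_weight_ge0 (i : T) (s : seq T) : 0 <= path_weight E i s.
Proof. by elim: s i => [|j s IHs] i //=; rewrite mulr_ge0. Qed.

(** The cycle extends to a permutation of [T] fixing all other points, which contribute [E j j = 1];
    [E_perm] bounds its weight. *)
Lemma cycle_weight_le1 (i : T) (s : seq T) :
  uniq (i :: s) -> path_weight E i (rcons s i) <= 1.
Proof.
move=> uniq_is; have next_inj := can_inj (prev_next uniq_is).
apply: le_trans (E_perm (perm next_inj)).
rewrite path_weight_next_at // big_uniq // big_mkcond le_eqVlt; apply/orP; left.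
apply/eqP/eq_bigr => j _; rewrite permE; case: ifPn => // j_is.
by rewrite (_ : next _ j = j) ?E_diag // next_nth (negPf j_is).
Qed.

(* Chains with repetitions may be ignored: by [cycle_weight_le1], cutting out a
   cycle does not decrease the weight. *)
Definition potential (i : T) : R :=
  \big[Num.max/0]_(k < #|T|)
    \big[Num.max/0]_(t : k.-tuple T | uniq (i :: t)) path_weight E i t.

Lemma path_weight_le_potential (i : T) (s : seq T) :
  uniq (i :: s) -> path_weight E i s <= potential i.
Proof.
move=> uniq_is.
have lt_s : (size s < #|T|)%N
  by have := max_card [in i :: s]; rewrite (card_uniqP uniq_is).
apply: le_trans (le_bigmax _ _ (Ordinal lt_s)).
by apply: (bigmax_sup (in_tuple s)).
Qed.

Lemma potential_gt0 (i : T) : 0 < potential i.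
Proof. exact: lt_le_trans ltr01 (path_weight_le_potential (s := [::]) isT). Qed.

(** Prepending [i] to a simple chain from [j] gives a simple chain from [i], unless [i] already
    occurs. In that case a cycle through [i] has been closed; its weight is at most 1 and it is cut
    out. *)
Lemma potential_step (i j : T) : E i j * potential j <= potential i.
Proof.
have [->|Eij_neq0] := eqVneq (E i j) 0; first by rewrite mul0r ltW ?potential_gt0.
have Eij_gt0 : 0 < E i j by rewrite lt0r Eij_neq0 E_ge0.
rewrite -ler_pdivlMl //.
have bound0 : 0 <= (E i j)^-1 * potential i.
  by rewrite mulr_ge0 ?invr_ge0 // ltW ?potential_gt0.
apply: bigmax_le => // k _; apply: bigmax_le => // t; rewrite ler_pdivlMl //.
move: (tval t) => {k}t uniq_jt; rewrite -[_ * _]/(path_weight E i (j :: t)).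
have [i_jt|i_jt] := boolP (i \in j :: t); last first.
  by apply: path_weight_le_potential; rewrite cons_uniq i_jt.
case/splitPr: i_jt uniq_jt => s1 s2; rewrite cat_uniq.
case/and3P=> uniq_s1 /hasPn s12 uniq_is2.
rewrite -cat_rcons path_weight_cat last_rcons.
apply: le_trans (path_weight_le_potential uniq_is2).
rewrite ler_piMl ?path_weight_ge0 // cycle_weight_le1 //= uniq_s1 andbT.
by apply: s12; rewrite mem_head.
Qed.

End Potential.

(** Multiplicative linear programming duality: the dual variables come from a potential for the
    matrix normalized by the optimal permutation [s]. *)
Lemma assignment_duality (R : realFieldType) (T : finType) (B : T -> T -> R)
    (s : {perm T}) :
  (forall i j, 0 <= B i j) -> 0 < \prod_i B i (s i) ->
  (forall t : {perm T}, \prod_i B i (t i) <= \prod_i B i (s i)) ->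
  exists u v : T -> R, [/\ forall i, 0 < u i, forall i, 0 < v i,
    forall i j, B i j <= u i * v j & \prod_i (u i * v i) = \prod_i B i (s i)].
Proof.
move=> B_ge0 Bs_gt0 s_opt.
have Bs i : 0 < B i (s i).
  rewrite lt0r B_ge0 andbT; apply: contraTneq Bs_gt0 => Bi0.
  by rewrite (bigD1 i) //= Bi0 mul0r ltxx.
(* Permuting the columns by [s] and dividing each by its optimal entry makes the identity optimal,
   with weight 1; the weight of [t] becomes that of [t * s] divided by that of [s]. *)
pose E i j := B i (s j) / B j (s j).
have E_ge0 i j : 0 <= E i j by rewrite mulr_ge0 // invr_ge0.
have E_diag i : E i i = 1 by rewrite /E divff // gt_eqF.
have E_perm (t : {perm T}) : \prod_i E i (t i) <= 1.
  rewrite big_split prodfV /=.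
  have -> : \prod_i B (t i) (s (t i)) = \prod_i B i (s i).
    by rewrite [RHS](reindex_perm t).
  rewrite ler_pdivrMr // mul1r; apply: le_trans (s_opt (t * s)%g).
  by under [leRHS]eq_bigr do rewrite permM.
pose p := potential E; have p_gt0 : forall i, 0 < p i by exact: potential_gt0.
(* With [j = s l], the inequality [E i l * p l <= p i] reads [B i j <= p i * (B l j / p l)]. In the
   total product the potentials cancel. *)
exists p, (fun j => B ((s^-1)%g j) j / p ((s^-1)%g j)).
have Bs' j : 0 < B ((s^-1)%g j) j by have := Bs ((s^-1)%g j); rewrite permKV.
split=> [//|j|i j|]; first by rewrite divr_gt0.
  have := potential_step E_ge0 E_diag E_perm i ((s^-1)%g j).
  by rewrite -/p /E permKV mulrA ler_pdivlMr // mulrAC ler_pdivrMr // [in leRHS]mulrC.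
rewrite big_split big_split /= prodfV.
rewrite [X in _ * (X * _)](reindex_perm s) /=.
rewrite [X in _ * (_ / X)](reindex_perm s) /=.
under [X in _ * (X * _)]eq_bigr do rewrite permK.
under [X in _ * (_ / X)]eq_bigr do rewrite permK.
by rewrite mulrCA divff ?mulr1 // gt_eqF // prodr_gt0.
Qed.

(** * Scaling by the tropical characteristic polynomial *)

Lemma prod_setC_const (R : pzRingType) (n : nat) (I : {set 'I_n}) (x : R) :
  \prod_(i | i \notin I) x = x ^+ (n - #|I|).
Proof.
have -> : (n - #|I| = #|~: I|)%N by rewrite [RHS]cardsCs finset.setCK card_ord.
by rewrite -prodr_const; apply: eq_bigl => i; rewrite inE.
Qed.

Lemma tropical_scaling (R : realType) (n : nat) (M : 'M[R]_n) (x : R) :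
  0 < x -> (forall i j, 0 <= M i j) ->
  exists u v : 'I_n -> R, [/\ forall i, 0 < u i, forall i, 0 < v i,
    forall i j, M i j <= u i * v j, forall i, x <= u i * v i &
    \prod_i (u i * v i) <= trop_char_poly M x].
Proof.
move=> x_gt0 M_ge0.
pose B i j := if i == j then Num.max (M i j) x else M i j.
have B_ge0 i j : 0 <= B i j.
  by rewrite /B; case: eqP => // _; rewrite le_max M_ge0.
have MB i j : M i j <= B i j by rewrite /B; case: eqP => // _; rewrite le_max lexx.
have xB i : x <= B i i by rewrite /B eqxx le_max lexx orbT.
pose w (t : {perm 'I_n}) := \prod_i B i (t i).
have [s _ s_opt] := @arg_maxP _ _ _ 1%g xpredT w isT.
have [||u [v [u_gt0 v_gt0 Buv uvB]]] := assignment_duality B_ge0 (s := s).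
(* The identity has positive weight, since the diagonal of [B] is at least [x]. *)
- apply: lt_le_trans (s_opt 1%g isT); apply: prodr_gt0 => i _.
  by rewrite perm1; apply: lt_le_trans (xB i).
- by move=> t; apply: s_opt.
exists u, v; split=> // [i j|i|]; first exact: le_trans (MB i j) (Buv i j).
  exact: le_trans (xB i) (Buv i i).
rewrite uvB.
(* [I] collects the rows where [s] uses an entry of [M]. Elsewhere [s] fixes the index and the entry
   is [x], so the optimal weight is bounded by the term of degree [n - #|I|] of the polynomial. *)
pose I := [set i | M i (s i) == B i (s i)].
have sI : perm_on I s.
  apply/fintype.subsetP => i; rewrite !inE; apply: contraR.
  by rewrite /B [i == _]eq_sym; case: (s i == i); rewrite ?eqxx.
have le_I : (#|I| < n.+1)%N by rewrite ltnS -[n in (_ <= n)%N]card_ord max_card.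
apply: le_trans (le_bigmax _ _ (Ordinal le_I)) => /=.
rewrite (bigID (mem I)) /=.
have -> : \prod_(i | i \notin I) B i (s i) = x ^+ (n - #|I|).
  rewrite -prod_setC_const; apply: eq_bigr => i.
  rewrite inE /B; case: (i == s i); last by rewrite eqxx.
  by rewrite /Num.max; case: ifP => // _; rewrite eqxx.
apply: ler_wpM2r; first by rewrite exprn_ge0 // ltW.
rewrite /trop_tr; apply: (bigmax_sup I) => //; apply: (bigmax_sup s) => //.
by apply: ler_prod => i; rewrite inE => /eqP <-; rewrite lexx M_ge0.
Qed.

(** * From the scaling to the eigenvalue products *)

(** The Leibniz expansion is bounded term by term: a term with a zero entry vanishes on both sides,
    and any other one is at most the product of the scaling factors. *)
Lemma norm_det_compound_le (R : realType) (n k : nat) (A : 'M[R[i]]_n)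
    (u v : 'I_n -> R) (a b : 'I_#|ksub n k|) :
  (forall i j, cabs (A i j) <= u i * v j) ->
  `|det_compound k A a b| <=
    (\prod_(i in val (enum_val a)) u i)%:C *
    (\prod_(i in val (enum_val b)) v i)%:C * per_compound k (pat A) a b.
Proof.
move=> Auv; rewrite !mxE /determinant /permanent mulr_sumr.
apply: le_trans (ler_norm_sum _ _ _) _; apply: ler_sum => s _.
rewrite normrM normrX normrN1 expr1n mul1r normr_prod.
rewrite -!prod_ksub_nth [X in _ * X%:C * _](reindex_perm s) /=.
rewrite !rmorph_prod -!big_split /=; apply: ler_prod => r _; rewrite normr_ge0 !mxE /=.
case: eqP => [->|_]; first by rewrite normr0 mulr0.
by rewrite mulr1 -rmorphM -cabsE lecR.
Qed.

Lemma eigenvalue_products_trop (R : realType) (n k : nat) (A : 'M[R[i]]_n)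
    (lam : 'I_n -> R[i]) (x : R) (I : {set 'I_n}) :
  eigenvalues_of A lam -> 0 < x -> #|I| == k ->
  cabs (\prod_(i in I) lam i) <= spectral_radius (per_compound k (pat A)) *
    (trop_char_poly (abs_mx A) x / x ^+ (n - k)).
Proof.
move=> Alam x_gt0 Ik.
have [|u [v [u_gt0 v_gt0 Auv xuv uvq]]] := tropical_scaling (M := abs_mx A) x_gt0.
  by move=> i j; rewrite mxE cabs_ge0.
have {}Auv i j : cabs (A i j) <= u i * v j by have := Auv i j; rewrite mxE.
have P_ge0 (a b : 'I_#|ksub n k|) : 0 <= per_compound k (pat A) a b.
  rewrite mxE; apply: sumr_ge0 => s _; apply: prodr_ge0 => i _.
  by rewrite !mxE ler0n.
have q_ge0 : 0 <= trop_char_poly (abs_mx A) x.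
  by apply: le_trans uvq; apply: prodr_ge0 => i _; rewrite mulr_ge0 // ltW.
(* Weighting by [v] moves the factor of the column set into [d b] and leaves the product of all
   [u i * v i] over the row set. *)
pose d (a : 'I_#|ksub n k|) : R[i] := (\prod_(i in val (enum_val a)) v i)%:C.
apply: (eigenvalue_products_le Alam (d := d)) => // [a||a b].
- by rewrite ltcR prodr_gt0.
- by rewrite divr_ge0 // exprn_ge0 ?ltW.
have d_gt0 (c : 'I_#|ksub n k|) : 0 < d c by rewrite ltcR prodr_gt0.
apply: le_trans (ler_wpM2r (ltW (d_gt0 a)) (norm_det_compound_le a b Auv)) _.
pose K := val (enum_val a).
have le_c : \prod_(i in K) u i * \prod_(i in K) v i <=
    trop_char_poly (abs_mx A) x / x ^+ (n - k).
  rewrite ler_pdivlMr ?exprn_gt0 //; apply: le_trans uvq.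
  (* Each of the [n - k] factors [u i * v i] outside [K] is at least [x]. *)
  rewrite [leRHS](bigID (mem K)) /= big_split /=; apply: ler_wpM2l.
    by rewrite mulr_ge0 // prodr_ge0 // => i _; apply: ltW.
  rewrite -(eqP (valP (enum_val a))) -prod_setC_const.
  by apply: ler_prod => i _; rewrite xuv ltW.
rewrite -/(d b) -/K [leLHS](_ : _ =
  (\prod_(i in K) u i * \prod_(i in K) v i)%:C * (per_compound k (pat A) a b * d b)).
  by rewrite -mulrA ler_wpM2r ?lecR // mulr_ge0 // ltW.
by rewrite rmorphM /=; ring.
Qed.

Theorem theorem5 (R : realType) (n : nat) (A : 'M[R[i]]_n)
    (lam : 'I_n -> R[i]) (gam : 'I_n -> R)
    (hlam : eigenvalues_of A lam)
    (hlam_sorted : forall i j : 'I_n, (i <= j)%N -> cabs (lam j) <= cabs (lam i))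
    (hgam : ctrop_eigenvalues_of A gam)
    (k : nat) (hk1 : (1 <= k)%N) (hkn : (k <= n)%N) :
  cabs (\prod_(i < n | (i < k)%N) lam i) <=
    spectral_radius (per_compound k (pat A)) * \prod_(i < n | (i < k)%N) gam i.
Proof.
have [gam_ge0 gam_sorted q_gam] := hgam.
set rho := spectral_radius _; set L := cabs _.
have rho_ge0 : 0 <= rho by exact: spectral_radius_ge0.
have lt_k1n : (k.-1 < n)%N by rewrite prednK.
(* Indices start at 0, so [gam l] is the [k]-th tropical eigenvalue. *)
pose l := Ordinal lt_k1n; have lt_lk : (l < k)%N by rewrite /= prednK.
pose I := [set i : 'I_n | (i < k)%N].
have card_I : #|I| = k.
  rewrite -sum1_card (eq_bigl (fun i : 'I_n => (i < k)%N)) => [|i]; last by rewrite inE.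
  by rewrite (big_ord_narrow hkn) sum1_card card_ord.
(* For [x] at least [gam l], the factors of index [k] and beyond all equal [x] and cancel against
   [x ^+ (n - k)]. *)
have bound x : 0 < x -> gam l <= x ->
    L <= rho * \prod_(i < n | (i < k)%N) Num.max x (gam i).
  move=> x_gt0 gam_x.
  have := eigenvalue_products_trop hlam x_gt0 (introT eqP card_I).
  rewrite (q_gam _ (ltW x_gt0)) [X in X / _](bigID (fun i : 'I_n => (i < k)%N)) /=.
  have -> : \prod_(i in I) lam i = \prod_(i < n | (i < k)%N) lam i.
    by apply: eq_bigl => i; rewrite inE.
  have -> : \prod_(i < n | ~~ (i < k)%N) Num.max x (gam i) = x ^+ (n - k).
    rewrite -[k in RHS]card_I -prod_setC_const; apply: eq_big => [i|i ki].
      by rewrite inE.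
    rewrite max_l //; apply: le_trans gam_x; apply: gam_sorted => /=.
    by rewrite (leq_trans (leq_pred k)) // leqNgt.
  by rewrite mulfK // expf_neq0 // gt_eqF.
have [gam_l_gt0|gam_l_le0] := ltP 0 (gam l).
  have := bound _ gam_l_gt0 (lexx _).
  rewrite (eq_bigr gam) // => i lt_ik; rewrite max_r //; apply: gam_sorted => /=.
  by rewrite -ltnS prednK.
have gam_l : gam l = 0 by apply/eqP; rewrite eq_le gam_l_le0 gam_ge0.
rewrite [X in _ <= _ * X](bigD1 l) //= gam_l mul0r mulr0 leNgt; apply/negP => L_gt0.
(* Here [gam l = 0] and letting [x] tend to [0] in [bound] forces [L = 0]. *)
pose K := \prod_(i < n | (i < k)%N && (i != l)) Num.max 1 (gam i).
have K_ge0 : 0 <= K by apply: prodr_ge0 => i _; rewrite le_max ler01.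
have rhoK : 0 <= rho * K by rewrite mulr_ge0.
(* With [x = L / D], the term [L] in [D] ensures [x <= 1], while [D > rho * K] contradicts the bound
   [L <= rho * (x * K)]. *)
pose D := L + rho * K + 1.
have D_gt0 : 0 < D by rewrite ltr_wpDl // addr_ge0 // ltW.
have x_gt0 : 0 < L / D by rewrite divr_gt0.
have x_le1 : L / D <= 1.
  by rewrite ler_pdivrMr // mul1r /D -addrA lerDl addr_ge0.
have : L <= rho * (L / D * K).
  apply: le_trans (bound _ x_gt0 _) _; first by rewrite gam_l ltW.
  apply: ler_wpM2l => //; rewrite (bigD1 l) //= gam_l (max_l (ltW x_gt0)).
  apply: ler_wpM2l; first exact: ltW.
  apply: ler_prod => i _; rewrite le_max (ltW x_gt0) /=.
  by rewrite ge_max !le_max x_le1 lexx orbT.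
rewrite mulrCA mulrAC ler_pdivlMr // ler_pM2l // leNgt => /negP; apply.
by rewrite /D addrAC ltr_pwDl // addr_gt0.
Qed.
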